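(* Let $p \geq 3$ be a prime, $n \geq 1$ an integer, $m = p^n - 1$, and $R = GF(p^n) \times GF(p^n)$. Then: (1) $ZD(R) = \Gamma(R) = K_{m,m}$. (2) If $4 \nmid m$, then $UD(R)$ is the disjoint union of $m/2$ copies of $K_{m,m}$. (3) If $4 \mid m$, then $UD(R)$ is the disjoint union of two copies of $K_m$ and $(m-2)/2$ copies of $K_{m,m}$. (4) If $4 \nmid m$, then $TD(R)$ is the disjoint union of $(m+2)/2$ copies of $K_{m,m}$. (5) If $4 \mid m$, then $TD(R)$ is the disjoint union of two copies of $K_m$ and $m/2$ copies of $K_{m,m}$.
   Context: $GF(q)$ denotes the finite field with $q$ elements. For a commutative ring $A$ with $1\neq 0$ and $R = A \times A$, the dot product of $x=(x_1,x_2)$ and $y=(y_1,y_2)$ in $R$ is $x\cdot y = x_1y_1+x_2y_2 \in A$. The total dot product graph $TD(R)$ is the simple undirected graph with vertex set $R \setminus \{(0,0)\}$, in which two distinct vertices $x,y$ are adjacent if and only if $x\cdot y = 0$ in $A$. $Z(R)$ is the set of zero-divisors of $R$ (including $0$) and $U(R)$ the group of units of $R$. The zero-divisor dot product graph $ZD(R)$ is the induced subgraph of $TD(R)$ with vertex set $Z(R)\setminus\{(0,0)\}$, and the unit dot product graph $UD(R)$ is the induced subgraph of $TD(R)$ with vertex set $U(R)$. The zero-divisor graph $\Gamma(R)$ is the simple graph with vertex set $Z(R)\setminus\{0\}$, in which distinct $x,y$ are adjacent if and only if $xy=0$ (ring product in $R$). $K_m$ is the complete graph on $m$ vertices and $K_{m,m}$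 the complete bipartite graph with parts of size $m$ and $m$; equality with such a graph means isomorphism, while $ZD(R)=\Gamma(R)$ is equality of graphs on the same vertex set. A graph is the disjoint union of given graphs if its vertex set is partitioned into subsets inducing (isomorphic copies of) those graphs, with no edges between vertices in different subsets. *)

(* Defs.v *)
From HB Require Import structures.
From mathcomp Require Import all_boot all_order all_fingroup all_algebra all_field.

Set Implicit Arguments.
Unset Strict Implicit.
Unset Printing Implicit Defensive.

Import GRing.Theory.
Local Open Scope ring_scope.

(* The vertices are a subset of an ambient finite type, so that graphs living
   in the same ring can be compared by Leibniz equality. *)
Record sgraph := SGraph {
  ambient : finType;
  vset : {set ambient};
  edges : {set {set ambient}};
  edgesP : edges \subset [set e in powerset vset | #|e| == 2%N]
}.

Definition adj (G : sgraph) (x y : ambient G) : bool := [set x; y] \in edges G.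

Definition rel_edges (T : finType) (V : {set T}) (r : rel T) : {set {set T}} :=
  [set [set x; y] | x in V, y in V & (x != y) && r x y].

Lemma rel_edgesP (T : finType) (V : {set T}) (r : rel T) :
  rel_edges V r \subset [set e in powerset V | #|e| == 2%N].
Proof.
apply/subsetP=> _ /imset2P[x y xV /[!inE]/and3P[yV neq_xy _] ->].
by rewrite subUset !sub1set xV yV cards2 neq_xy.
Qed.

Definition rel_graph (T : finType) (V : {set T}) (r : rel T) : sgraph :=
  SGraph (rel_edgesP V r).

Lemma rel_graph_adj (T : finType) (V : {set T}) (r : rel T) (x y : T) :
    symmetric r ->
  @adj (rel_graph V r) x y = [&& x \in V, y \in V, x != y & r x y].
Proof.
move=> r_sym; apply/idP/idP; last first.
  move=> /and4P[xV yV neq_xy rxy]; apply/imset2P.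
  by exists x y; rewrite // inE yV neq_xy.
case/imset2P=> a b aV /[!inE]/and3P[bV neq_ab rab] eq_xy_ab.
have neq_xy : x != y.
  move/(congr1 (fun e : {set T} => #|e|)): eq_xy_ab.
  by rewrite !cards2 neq_ab; case: (x != y).
have : x \in [set a; b] by rewrite -eq_xy_ab set21.
have : y \in [set a; b] by rewrite -eq_xy_ab set22.
rewrite !inE neq_xy /= => /orP[]/eqP y_ab /orP[]/eqP x_ab; subst x y.
- by rewrite eqxx in neq_xy.
- by rewrite aV bV r_sym.
- by rewrite aV bV.
- by rewrite eqxx in neq_xy.
Qed.

Lemma induced_subproof (G : sgraph) (S : {set ambient G}) :
  edges G ::&: S \subset [set e in powerset (vset G :&: S) | #|e| == 2%N].
Proof.
apply/subsetP=> e /[!inE] /andP[/(subsetP (edgesP G))].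
by rewrite !inE subsetI => /andP[-> ->] ->.
Qed.

Definition induced (G : sgraph) (S : {set ambient G}) : sgraph :=
  SGraph (induced_subproof S).

Definition isomorphic (G H : sgraph) : Prop :=
  exists2 f : {x | x \in vset G} -> {y | y \in vset H},
    bijective f &
    forall x y, adj (val (f x)) (val (f y)) = adj (val x) (val y).

Definition disjoint_union_of (G : sgraph) (I : finType) (H : I -> sgraph) : Prop :=
  exists P : I -> {set ambient G},
    [/\ \bigcup_i P i = vset G,
        forall i j, i != j -> [disjoint P i & P j],
        forall i, isomorphic (induced (P i)) (H i) &
        forall i j x y, i != j -> x \in P i -> y \in P j -> ~~ adj x y].

Definition complete_graph (m : nat) : sgraph :=
  rel_graph [set: 'I_m] (fun _ _ => true).

Definition complete_bipartite (m n : nat) : sgraph :=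
  rel_graph [set: 'I_m + 'I_n]
    (fun x y => match x, y with
                | inl _, inr _ | inr _, inl _ => true
                | _, _ => false
                end).

(* finalg does not close its hierarchy under products. *)
HB.instance Definition _ (A B : finComNzRingType) :=
  GRing.NzRing.on (A * B)%type.
HB.instance Definition _ (A B : finComUnitRingType) :=
  GRing.NzRing.on (A * B)%type.

Definition zero_divisors (R : finComNzRingType) : {set R} :=
  [set x | [exists y, (y != 0) && (x * y == 0)]].

Definition units (R : finComUnitRingType) : {set R} :=
  [set x | x \is a GRing.unit].

Definition dot (A : finComNzRingType) (x y : A * A) : A :=
  x.1 * y.1 + x.2 * y.2.

(* Here R = A * A, with its componentwise ring structure. *)
Definition TD (A : finComNzRingType) : sgraph :=
  rel_graph [set~ (0 : A * A)] (fun x y => dot x y == 0).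

Definition ZD (A : finComNzRingType) : sgraph :=
  @induced (TD A) (zero_divisors (A * A)%type :\ 0).

Definition UD (A : finComUnitRingType) : sgraph :=
  @induced (TD A) (units (A * A)%type).

Definition zero_divisor_graph (R : finComNzRingType) : sgraph :=
  rel_graph (zero_divisors R :\ 0) (fun x y => x * y == 0).

(* Main.v *)
Require Import Defs.
From HB Require Import structures.
From mathcomp Require Import all_boot all_order all_fingroup all_algebra all_field.
From mathcomp Require Import ring zify.

(** Let q be the order of F. Being orthogonal for the dot product depends only
    on the lines spanned by the two vectors: nonzero x and y are orthogonal
    exactly when the slope of y is the image of the slope of x under the map
    perp, which sends t to -1/t on the projective line over F and exchanges 0
    and infinity ([dot_slope]). Each slope is carried by q - 1 nonzero vectors
    ([card_slope]), and perp is an involution ([perpK]). So TD is the blow-up of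
    an involution of a set of q + 1 points, every point being replaced by q - 1
    vertices: an orbit {k, perp k} of two slopes gives a copy of K_{m,m} with
    m = q - 1, a fixed slope gives a copy of K_m, and there are no edges between
    different orbits ([disjoint_union_orbits]).

    The remaining work is to count the fixed points. They are the square roots
    of -1 ([card_perp_fixed]); as q is odd, there are two of them if 4 divides
    q - 1 and none otherwise ([card_sqrtN1]). All other slopes are
    paired off by perp.

    The slopes 0 and infinity form one orbit, whose vectors are the nonzero
    zero-divisors of F * F; the vectors of all other slopes are the units. Hence
    ZD is the copy of K_{m,m} over this orbit, and UD is TD deprived of it. On
    zero-divisors one of the two terms of the dot product always vanishes, so
    the dot product is zero if and only if the ring product is: ZD is the
    zero-divisor graph. *)

Import GRing.Theory.

(** * Graphs and their isomorphisms *)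

Lemma adj_sym {G : sgraph} (x y : ambient G) : adj x y = adj y x.
Proof. by rewrite /adj setUC. Qed.

Lemma adjxx {G : sgraph} (x : ambient G) : adj x x = false.
Proof.
apply/negP => /(subsetP (edgesP G)).
by rewrite inE cards2 eqxx andbF.
Qed.

Lemma induced_adj {G : sgraph} (S : {set ambient G}) (x y : ambient G) :
  @adj (induced S) x y = [&& adj x y, x \in S & y \in S].
Proof. by rewrite /adj /= inE subUset !sub1set. Qed.

Lemma eq_sgraph (T : finType) (V V' : {set T}) (E E' : {set {set T}})
    (EP : E \subset [set e in powerset V | #|e| == 2%N])
    (EP' : E' \subset [set e in powerset V' | #|e| == 2%N]) :
  V = V' -> E = E' -> SGraph EP = SGraph EP'.
Proof.
move=> eqV eqE; subst V' E'; congr SGraph; exact: bool_irrelevance.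
Qed.

Lemma induced_rel_graph (T : finType) (V : {set T}) (r : rel T) (S : {set T}) :
  @induced (rel_graph V r) S = rel_graph (V :&: S) r.
Proof.
apply: eq_sgraph => //; apply/setP=> e; rewrite inE; apply/andP/imset2P.
  case=> /imset2P[x y xV /setIdP[yV rxy] ->].
  rewrite subUset !sub1set => /andP[xS yS].
  by exists x y; rewrite // !inE ?xV ?xS // yV yS.
case=> x y /setIP[xV xS] /setIdP[/setIP[yV yS] rxy] ->.
rewrite subUset !sub1set xS yS; split=> //.
by apply/imset2P; exists x y; rewrite // inE yV.
Qed.

Lemma eq_rel_graph (T : finType) (V V' : {set T}) (r r' : rel T) :
    V = V' -> {in V &, forall x y, x != y -> r x y = r' x y} ->
  rel_graph V r = rel_graph V' r'.
Proof.
move=> <- eqr; apply: eq_sgraph => //.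
suff sub r1 r2 : {in V &, forall x y, x != y -> r1 x y = r2 x y} ->
    rel_edges V r1 \subset rel_edges V r2.
  by apply/eqP; rewrite eqEsubset !sub // => x y xV yV neq_xy; rewrite eqr.
move=> eq12; apply/subsetP=> _ /imset2P[x y xV /setIdP[yV /andP[neq_xy rxy]] ->].
by apply/imset2P; exists x y; rewrite // inE yV neq_xy -eq12.
Qed.

(** The bijection is given in the direction from the model graph H to G, by a
    map between the ambient types: enumerations of the parts of G then need no
    default value. *)
Lemma isomorphic_inv (G H : sgraph) (h : ambient H -> ambient G) :
    {in vset H, forall y, h y \in vset G} ->
    {in vset H &, injective h} ->
    #|vset G| = #|vset H| ->
    {in vset H &, forall x y, adj (h x) (h y) = adj x y} ->
  isomorphic G H.
Proof.
move=> hV hinj eqGH hadj.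
pose f (y : {y | y \in vset H}) : {x | x \in vset G} :=
  Sub (h (val y)) (hV _ (valP y)).
have /inj_card_bij : injective f.
  move=> y z /(congr1 val) /= /hinj eqyz.
  by apply: val_inj; apply: eqyz; apply: valP.
rewrite !card_sig => fbij.
have [|g fK gK] := fbij.
  rewrite (eq_card (B := mem (vset G))) //.
  by rewrite [leqRHS](eq_card (B := mem (vset H))) // eqGH.
exists g; first by exists f.
by move=> x y; rewrite -{2}(gK x) -{2}(gK y) hadj //; apply: valP.
Qed.

Lemma isomorphic_complete (G : sgraph) (m : nat) :
    #|vset G| = m ->
    {in vset G &, forall x y, x != y -> adj x y} ->
  isomorphic G (complete_graph m).
Proof.
move=> cardG adjG.
apply: (@isomorphic_inv G (complete_graph m)
  (fun i => enum_val (cast_ord (esym cardG) i))) => //=.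
- by move=> i _; apply: enum_valP.
- by move=> i j _ _ /enum_val_inj /cast_ord_inj.
- by rewrite cardG cardsT card_ord.
move=> i j _ _; rewrite rel_graph_adj // !inE andbT.
have [->|neq_ij] := eqVneq i j; first exact: adjxx.
apply: adjG; rewrite ?enum_valP //.
by apply: contra neq_ij => /eqP /enum_val_inj /cast_ord_inj ->.
Qed.

Lemma isomorphic_complete_bipartite (G : sgraph) (A B : {set ambient G})
    (a b : nat) :
    vset G = A :|: B -> [disjoint A & B] -> #|A| = a -> #|B| = b ->
    {in A & B, forall x y, adj x y} ->
    {in A &, forall x y, ~~ adj x y} ->
    {in B &, forall x y, ~~ adj x y} ->
  isomorphic G (complete_bipartite a b).
Proof.
move=> VG disAB cA cB adjAB adjA adjB.
pose h (u : 'I_a + 'I_b) := match u with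
  | inl i => enum_val (cast_ord (esym cA) i)
  | inr j => enum_val (cast_ord (esym cB) j) end.
have hA i : h (inl i) \in A by apply: enum_valP.
have hB j : h (inr j) \in B by apply: enum_valP.
have hAB i j : h (inl i) <> h (inr j).
  by move=> eqh; move: (disjointFr disAB (hA i)); rewrite eqh hB.
apply: (@isomorphic_inv G (complete_bipartite a b) h) => //=.
- by move=> [i|j] _; rewrite VG inE ?hA ?hB ?orbT.
- move=> [i|i] [j|j] _ _ eqh.
  + by move/enum_val_inj/cast_ord_inj: eqh => ->.
  + by case: (hAB _ _ eqh).
  + by case: (hAB _ _ (esym eqh)).
  + by move/enum_val_inj/cast_ord_inj: eqh => ->.
- rewrite VG cardsU disjoint_setI0 // cards0 subn0 cA cB.
  by rewrite cardsT card_sum !card_ord.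
move=> u v _ _; rewrite rel_graph_adj; last by case=> ? [].
rewrite !inE /=; case: u v => [i|i] [j|j] /=; rewrite ?andbF ?andbT.
- exact: negbTE (adjA _ _ (hA i) (hA j)).
- exact: adjAB (hA i) (hB j).
- by rewrite adj_sym; apply: adjAB (hA j) (hB i).
- exact: negbTE (adjB _ _ (hB i) (hB j)).
Qed.

Lemma disjoint_union_reindex (G : sgraph) (I J : finType) (H : I -> sgraph)
    (H' : J -> sgraph) (f : J -> I) :
    bijective f -> (forall j, H' j = H (f j)) ->
  disjoint_union_of G H -> disjoint_union_of G H'.
Proof.
move=> f_bij eqH [P [coverP disP isoP adjP]]; exists (P \o f).
have f_inj := bij_inj f_bij.
split=> /=.
- by rewrite -coverP [RHS](reindex f) //; apply: onW_bij.
- by move=> i j neq_ij; apply: disP; rewrite inj_eq.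
- by move=> j; rewrite eqH.
- by move=> i j x y neq_ij; apply: adjP; rewrite inj_eq.
Qed.

(** Lets the case of an involution without fixed points be read off the general
    one, in which the index set has a summand for the fixed points. *)
Lemma disjoint_union_inr (G : sgraph) (b : nat) (H H' : sgraph) :
    disjoint_union_of G (fun i : 'I_0 + 'I_b => if i is inl _ then H else H') ->
  disjoint_union_of G (fun _ : 'I_b => H').
Proof.
apply: (@disjoint_union_reindex _ _ _ _ _ inr) => //.
by apply: inj_card_bij => [i j []|]; rewrite // card_sum !card_ord.
Qed.

(** * Blowing up an involution *)

Definition pair_orbit {K : finType} (s : K -> K) (k : K) : {set K} :=
  [set k; s k].

Lemma pair_orbit_eq {K : finType} (s : K -> K) (k l : K) :
  involutive s -> l \in pair_orbit s k -> pair_orbit s l = pair_orbit s k.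
Proof.
by move=> sK; rewrite !inE => /orP[]/eqP-> //; rewrite /pair_orbit sK setUC.
Qed.

(** The fibre of [pair_orbit s] over the orbit of k is that orbit itself, which
    has two elements. *)
Lemma card_orbits {K : finType} (s : K -> K) (D : {set K}) :
    involutive s -> {in D, forall k, s k \in D} -> {in D, forall k, s k != k} ->
  #|D| = 2 * #|pair_orbit s @: D|.
Proof.
move=> sK sD sfree.
rewrite -sum1_card (partition_big_imset (pair_orbit s)) /= mulnC -sum_nat_const.
apply: eq_bigr => _ /imsetP[k kD ->].
rewrite sum1_card -[RHS](_ : #|pair_orbit s k| = 2); last first.
  by rewrite cards2 eq_sym sfree.
apply: eq_card => l.
rewrite -[LHS]/((l \in D) && (pair_orbit s l == pair_orbit s k)).
apply/andP/idP => [[_ /eqP <-]|lk]; first by rewrite !inE eqxx.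
split; last by rewrite (pair_orbit_eq s k).
by case/set2P: lk => -> //; apply: sD.
Qed.

(** Think of c as a colouring of the vertices. A neighbour of a vertex of colour
    k has colour s k, so edges stay within the preimages of the orbits of s.
    Over a fixed point any two vertices are adjacent; over {k, s k} with
    s k != k the vertices of colour k are joined to those of colour s k, and two
    vertices of the same colour are not adjacent. *)
Lemma disjoint_union_orbits (G : sgraph) (K : finType) (c : ambient G -> K)
    (s : K -> K) (D : {set K}) (m a b : nat) :
    involutive s ->
    {in D, forall k, s k \in D} ->
    {in vset G, forall x, c x \in D} ->
    {in D, forall k, #|[set x in vset G | c x == k]| = m} ->
    {in vset G &, forall x y, adj x y = (x != y) && (c y == s (c x))} ->
    #|[set k in D | s k == k]| = a -> #|D| = a + 2 * b ->
  disjoint_union_of G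
    (fun i : 'I_a + 'I_b =>
       if i is inl _ then complete_graph m else complete_bipartite m m).
Proof.
move=> sK sD cD fibD adjG.
set E := [set k in D | s k == k] => cardE cardD.
have sED : E \subset D by apply/subsetP=> k; rewrite inE => /andP[].
set O := pair_orbit s @: (D :\: E).
have DE k : k \in D :\: E -> [/\ k \in D, s k \in D & s k != k].
  by rewrite !inE => /andP[/nandP[/negP//|skk] kD]; rewrite kD sD.
have cardO : #|O| = b.
  have: 2 * #|O| = 2 * b.
    rewrite -card_orbits //.
    - by rewrite cardsDS // cardD cardE addKn.
    - by move=> k /DE[kD skD skk]; rewrite !inE sK skD eq_sym (negbTE skk).
    - by move=> k /DE[].
  by move/eqP; rewrite eqn_mul2l => /eqP.
have sDE k : k \in D :\: E -> s k \in D :\: E.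
  by case/DE=> kD skD skk; rewrite !inE sK skD eq_sym (negbTE skk).
(* B enumerates the orbits of s on D: those of the fixed points, then the
   two-element ones. *)
pose B (i : 'I_a + 'I_b) : {set K} := match i with
  | inl i => pair_orbit s (enum_val (cast_ord (esym cardE) i))
  | inr j => enum_val (cast_ord (esym cardO) j) end.
have BE i k :
    k \in B (inl i) -> k \in E /\ k = enum_val (cast_ord (esym cardE) i).
  have /setIdP[_ /eqP sll] := enum_valP (cast_ord (esym cardE) i).
  by rewrite /= /pair_orbit sll setUid => /set1P->; split=> //; apply: enum_valP.
have BO j k :
    k \in B (inr j) -> k \in D :\: E /\ B (inr j) = pair_orbit s k.
  have /imsetP[l lDE Bj] := enum_valP (cast_ord (esym cardO) j).
  rewrite /= Bj.
  move=> kl; split; last by rewrite (pair_orbit_eq s l).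
  by case/set2P: kl => -> //; apply: sDE.
have Bdis i j k : k \in B i -> k \in B j -> i = j.
  case: i j => [i|i] [j|j].
  - by move=> /BE[_ ->] /BE[_ /enum_val_inj/cast_ord_inj->].
  - by move=> /BE[kE _] /BO[]; rewrite inE kE.
  - by move=> /BO[+ _] /BE[kE _]; rewrite inE kE.
  - by move=> /BO[_ Bi] /BO[_]; rewrite -Bi => /enum_val_inj/cast_ord_inj->.
have Bs i k : k \in B i -> s k \in B i.
  case: i => [i|j] ki.
    by have [/setIdP[_ /eqP->]] := BE _ _ ki.
  by have [_ ->] := BO _ _ ki; rewrite !inE eqxx orbT.
have Bcover k : k \in D -> exists i, k \in B i.
  move=> kD; case: (boolP (k \in E)) => [kE|kE].
    exists (inl (cast_ord cardE (enum_rank_in kE k))).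
    by rewrite /= cast_ordK enum_rankK_in // !inE eqxx.
  have kO : pair_orbit s k \in O by apply: imset_f; rewrite inE kE.
  exists (inr (cast_ord cardO (enum_rank_in kO (pair_orbit s k)))).
  by rewrite /= cast_ordK enum_rankK_in // !inE eqxx.
pose P i := [set x in vset G | c x \in B i].
exists P; split.
- apply/setP=> x; apply/bigcupP/idP => [[i _ /setIdP[]] //|xG].
  by have [i ci] := Bcover _ (cD x xG); exists i; rewrite // inE xG.
- move=> i j neq_ij; apply/pred0P=> x /=; apply/negP=> /andP[].
  move=> /setIdP[_ ci] /setIdP[_ cj].
  by case/eqP: neq_ij; apply: Bdis ci cj.
- move=> [i|j].
    have EP x : x \in P (inl i) ->
        s (c x) = c x /\ c x = enum_val (cast_ord (esym cardE) i).
      by move=> /setIdP[_ /BE[/setIdP[_ /eqP sx] cx]].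
    apply: isomorphic_complete.
      have /setIdP[kD _] := enum_valP (cast_ord (esym cardE) i).
      rewrite -(fibD _ kD) /=; apply: eq_card => x; rewrite !inE andbA andbb.
      case: (boolP (x \in vset G)) => //= xG.
      have /setIdP[_ /eqP sll] := enum_valP (cast_ord (esym cardE) i).
      by rewrite sll orbb.
    move=> x y /setIP[xG xP] /setIP[yG yP] neq_xy.
    rewrite induced_adj adjG // neq_xy xP yP /=.
    by have [-> ->] := EP x xP; have [_ ->] := EP y yP; rewrite eqxx.
  have /imsetP[k kDE Bj] := enum_valP (cast_ord (esym cardO) j).
  have [kD skD skk] := DE _ kDE.
  have fib_adj x y : x \in vset G -> y \in vset G ->
      c x \in pair_orbit s k -> c y \in pair_orbit s k ->
      @adj (induced (P (inr j))) x y = (c y != c x).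
    move=> xG yG cx cy; rewrite induced_adj adjG // !inE xG yG /= Bj cx cy !andbT.
    have [->|_] := eqVneq x y; first by rewrite eqxx.
    by case/set2P: cx => ->; case/set2P: cy => ->;
      rewrite ?sK ?eqxx ?(eq_sym k (s k)) ?(negbTE skk).
  apply: (isomorphic_complete_bipartite (induced (P (inr j)))
    [set x in vset G | c x == k] [set x in vset G | c x == s k]).
  + apply/setP=> x; rewrite !inE /= Bj !inE.
    by case: (x \in vset G).
  + apply/pred0P=> x /=; rewrite !inE; apply/negP=> /andP[/andP[_ /eqP->]].
    by rewrite eq_sym (negbTE skk) andbF.
  + exact: fibD.
  + exact: fibD.
  + move=> x y /setIdP[xG /eqP cx] /setIdP[yG /eqP cy].
    by rewrite fib_adj ?cx ?cy ?inE ?eqxx ?orbT.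
  + move=> x y /setIdP[xG /eqP cx] /setIdP[yG /eqP cy].
    by rewrite fib_adj ?cx ?cy ?inE ?eqxx ?orbT.
  + move=> x y /setIdP[xG /eqP cx] /setIdP[yG /eqP cy].
    by rewrite fib_adj ?cx ?cy ?inE ?eqxx ?orbT.
- move=> i j x y neq_ij /setIdP[xG ci] /setIdP[yG cj].
  rewrite adjG //; apply: contra neq_ij => /andP[_ /eqP cy].
  by apply/eqP/(Bdis _ _ (c y)) => //; rewrite cy; apply: Bs _ _ ci.
Qed.

(** * The slopes of the plane *)

Local Open Scope ring_scope.

(** The type [option F] stands for the projective line over F, with [None] for
    the point at infinity. At x = 0 the value is arbitrary. *)
Definition slope {F : fieldType} (x : F * F) : option F :=
  if x.1 == 0 then None else Some (x.2 / x.1).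

(** The map t |-> -1/t of the projective line: the slope of the orthogonal of a
    line of slope t. *)
Definition perp {F : fieldType} (k : option F) : option F :=
  match k with
  | None => Some 0
  | Some t => if t == 0 then None else Some (- t^-1)
  end.

Lemma perpK (F : fieldType) : involutive (@perp F).
Proof.
case=> [t|] /=; last by rewrite eqxx.
have [->|t0] //= := eqVneq t 0.
by rewrite oppr_eq0 invr_eq0 (negbTE t0) invrN opprK invrK.
Qed.

(** When no coordinate vanishes, ac + bd = 0 is the equation d/c = -(b/a)^-1;
    the other cases are those in which a slope is 0 or infinity. *)
Lemma dot_slope (F : finFieldType) (x y : F * F) :
  x != 0 -> y != 0 -> (dot x y == 0) = (slope y == perp (slope x)).
Proof.
case: x y => [a b] [c d]; rewrite /dot /slope -!pair_eqE /pair_eq /=.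
have [->|a0] := eqVneq a 0; have [->|c0] := eqVneq c 0 => //=.
- by move=> b0 d0; rewrite mul0r add0r mulf_eq0 (negbTE b0) (negbTE d0).
- move=> b0 _; rewrite mul0r add0r (inj_eq Some_inj) !mulf_eq0 invr_eq0.
  by rewrite (negbTE b0) (negbTE c0) orbF.
- move=> _ d0; rewrite mulr0 add0r !mulf_eq0 invr_eq0.
  by rewrite (negbTE a0) (negbTE d0) !orbF; case: ifP.
move=> _ _; rewrite mulf_eq0 invr_eq0 (negbTE a0) orbF.
have [->|b0] := eqVneq b 0.
  by rewrite mul0r addr0 mulf_eq0 (negbTE a0) (negbTE c0).
rewrite (inj_eq Some_inj) -[RHS]subr_eq0 opprK.
have -> : d / c + (b / a)^-1 = (a * c + b * d) / (b * c).
  by field; rewrite a0 b0 c0.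
by rewrite [RHS]mulf_eq0 invr_eq0 mulf_eq0 (negbTE b0) (negbTE c0) !orbF.
Qed.

(** A line through the origin is parametrized by F, with the origin at
    parameter 0. *)
Lemma card_slope (F : finFieldType) (k : option F) :
  #|[set x : F * F | (x != 0) && (slope x == k)]| = (#|F| - 1)%N.
Proof.
pose u (c : F) : F * F := if k is Some t then (c, c * t) else (0, c).
have u_inj : injective u.
  by rewrite {}/u; case: k => [t|] c d [].
rewrite subn1 -(cardsC1 (0 : F)) -(card_imset _ u_inj).
apply: eq_card => -[a b]; rewrite inE -pair_eqE /pair_eq /slope /=.
apply/idP/imsetP => [|[c]].
  have [-> /andP[b0 /eqP kN]|a0 /eqP kS] := eqVneq a 0.
    by exists b; rewrite ?inE // /u -kN.
  by exists a; rewrite ?inE // /u -kS mulrC divfK.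
rewrite !inE /u {u_inj u} => c0; case: k => [t|] [-> ->]; last by rewrite eqxx c0.
by rewrite (negbTE c0) /= mulrAC divff // mul1r.
Qed.

(** For t != 0, -1/t = t means t ^+ 2 = -1; the points 0 and infinity are
    exchanged, and 0 is not a square root of -1. *)
Lemma card_perp_fixed (F : finFieldType) :
  #|[set k : option F | perp k == k]| = #|[set t : F | t ^+ 2 == -1]|.
Proof.
have Some_inj' : injective (@Some F) by move=> ? ? [].
rewrite -(card_imset _ Some_inj'); apply: eq_card => -[t|]; rewrite inE /=; last first.
  by apply/esym/imsetP => -[].
rewrite mem_imset // inE.
have [->|t0] := eqVneq t 0.
  by rewrite expr0n [RHS]eq_sym oppr_eq0 oner_eq0.
rewrite (inj_eq Some_inj') eqr_oppLR -(inj_eq (mulfI t0)) divff // mulrN -expr2.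
by rewrite eq_sym eqr_oppLR.
Qed.

(** * Square roots of -1 *)

(** Translation by 1 permutes F, so comparing the sums of x and of x + 1 over F
    gives q = 0 in F. As q is odd, 2 = 0 in F would then imply 1 = 0. *)
Lemma oppr1_neq1 (F : finFieldType) : odd #|F| -> -1 != 1 :> F.
Proof.
move=> oddF; apply/eqP=> N1.
have F0 : #|F|%:R = 0 :> F.
  apply: (addrI (\sum_(x : F) x)); rewrite addr0 {2}(reindex_inj (addIr 1)) /=.
  by rewrite big_split sumr_const.
move/eqP: F0; rewrite -(odd_double_half #|F|) oddF natrD -mul2n natrM.
have -> : 2 = 0 :> F by rewrite -[2]/(1 + 1) -{1}N1 addNr.
by rewrite mul0r addr0 oner_eq0.
Qed.

Lemma expf_card_sub1 (F : finFieldType) (x : F) : x != 0 -> x ^+ (#|F| - 1) = 1.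
Proof.
move=> x0; apply: (mulfI x0).
by rewrite -exprS mulr1 -subSn ?subn1 ?expf_card // (ltnW (finNzRing_gt1 F)).
Qed.

(** Write q - 1 = 4k. The polynomial X^2k - 1 cannot vanish at the 4k nonzero
    elements of F, so x^2k != 1 for some x != 0. Its square is 1, hence
    x^2k = -1 and x^k is a square root of -1. *)
Lemma sqrtN1_exists (F : finFieldType) :
  (4 %| #|F| - 1)%N -> exists i : F, i ^+ 2 = -1.
Proof.
move=> /dvdnP[k Fk].
have F1 : (1 < #|F|)%N := finNzRing_gt1 F.
have k0 : (0 < k)%N.
  by rewrite lt0n; apply: contraTneq F1 => k0; rewrite -subn_gt0 Fk k0.
have [x x0 xk] : exists2 x : F, x != 0 & x ^+ (k * 2) != 1.
  apply/exists_inP; rewrite -negb_forall_in; apply/negP=> /forall_inP x1.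
  have szP : size ('X^(k * 2) - 1 : {poly F}) = (k * 2).+1.
    by rewrite size_Xn_sub_1 // muln_gt0 k0.
  have P0 : ('X^(k * 2) - 1 : {poly F}) != 0 by rewrite -size_poly_eq0 szP.
  have rootP : all (root ('X^(k * 2) - 1)) (enum [set~ (0 : F)]).
    apply/allP=> y; rewrite mem_enum !inE => /x1/eqP y1.
    by rewrite rootE !hornerE y1 subrr.
  have := max_poly_roots P0 rootP (enum_uniq _).
  by rewrite szP -cardE cardsC1 -subn1 Fk ltnS leq_pmul2l.
exists (x ^+ k); rewrite -exprM; apply/eqP.
have: (x ^+ (k * 2)) ^+ 2 == 1 by rewrite -exprM -mulnA -Fk expf_card_sub1.
by rewrite sqrf_eq1 (negbTE xk).
Qed.

(** If 4 does not divide q - 1, then q - 1 = 2h with h odd, and a root t of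
    t ^+ 2 = -1 would satisfy 1 = t^(q - 1) = (-1)^h = -1. *)
Lemma card_sqrtN1 (F : finFieldType) :
  odd #|F| -> #|[set t : F | t ^+ 2 == -1]| =
    if (4 %| #|F| - 1)%N then 2%N else 0%N.
Proof.
move=> oddF.
have root_neq0 (t : F) : t ^+ 2 = -1 -> t != 0.
  apply: contra_eq_neq => ->.
  by rewrite expr0n eq_sym oppr_eq0 oner_eq0.
case: ifP => F4.
  have [i i2] := sqrtN1_exists F F4; have i0 := root_neq0 i i2.
  rewrite -[RHS](_ : #|[set i; - i]| = 2%N).
    by apply: eq_card => t; rewrite !inE -i2 eqf_sqr.
  by rewrite cards2 eq_sym -[i]mulr1 -mulrN (inj_eq (mulfI i0)) oppr1_neq1.
apply: eq_card0 => t; rewrite inE; apply/negP=> /eqP t2.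
have t0 := root_neq0 t t2.
have evenF : (#|F| - 1 = 2 * (#|F| - 1)./2)%N by lia.
have := expf_card_sub1 F t t0; rewrite evenF exprM t2 -signr_odd.
have -> : odd (#|F| - 1)./2 by move: F4; lia.
by move/eqP; rewrite expr1 (negbTE (oppr1_neq1 F oddF)).
Qed.

(** * The dot product graphs *)

Lemma dotC (A : finComNzRingType) (x y : A * A) : dot x y = dot y x.
Proof. by rewrite /dot mulrC [x.2 * _]mulrC. Qed.

Lemma TD_adj (F : finFieldType) (x y : F * F) :
  x != 0 -> y != 0 -> @adj (TD F) x y = (x != y) && (slope y == perp (slope x)).
Proof.
move=> x0 y0; rewrite rel_graph_adj; last by move=> u v; rewrite dotC.
by rewrite !inE x0 y0 /= dot_slope.
Qed.

Lemma unit_pair_slope (F : finFieldType) (x : F * F) :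
  (x \is a GRing.unit) = (x != 0) && (slope x \notin [set None; Some 0]).
Proof.
case: x => a b; rewrite -[LHS]/((a \is a GRing.unit) && (b \is a GRing.unit)).
rewrite !unitfE !inE -pair_eqE /pair_eq /slope /=.
have [_|a0] := eqVneq a 0; first by rewrite andbF.
by rewrite (inj_eq Some_inj) mulf_eq0 invr_eq0 (negbTE a0) orbF.
Qed.

Lemma zero_divisors_coord (F : finFieldType) (x : F * F) :
  (x \in zero_divisors (F * F)%type :\ 0) =
  (x != 0) && ((x.1 == 0) || (x.2 == 0)).
Proof.
rewrite !inE; case: x => a b; apply: andb_id2l => x0.
apply/existsP/orP => [[[c d] /andP[]]|].
  rewrite -!pair_eqE /pair_eq /= !mulf_eq0.
  have [_|a0] := eqVneq a 0; first by left.
  have [_|b0] := eqVneq b 0; first by right.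
  (* With a and b nonzero, the cofactor (c, d) would be zero. *)
  by case: eqP => //= _; case: eqP.
rewrite /=; case=> /eqP->; [exists (1, 0) | exists (0, 1)];
  by rewrite -!pair_eqE /pair_eq /= ?mul0r ?mulr0 ?eqxx ?oner_eq0 ?andbF.
Qed.

Lemma zero_divisors_slope (F : finFieldType) (x : F * F) :
  (x \in zero_divisors (F * F)%type :\ 0) =
  (x != 0) && (slope x \in [set None; Some 0]).
Proof.
rewrite zero_divisors_coord !inE /slope; case: x => a b; congr (_ && _) => /=.
have [_|a0] //= := eqVneq a 0.
by rewrite (inj_eq Some_inj) mulf_eq0 invr_eq0 (negbTE a0) orbF.
Qed.

Lemma disjoint_union_TD (F : finFieldType) (a b : nat) :
    #|[set t : F | t ^+ 2 == -1]| = a -> (#|F| + 1 = a + 2 * b)%N ->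
  disjoint_union_of (TD F)
    (fun i : 'I_a + 'I_b =>
       if i is inl _ then complete_graph (#|F| - 1)
       else complete_bipartite (#|F| - 1) (#|F| - 1)).
Proof.
move=> cardE cardF.
apply: (@disjoint_union_orbits (TD F) (option F) slope perp setT).
- exact: perpK.
- by move=> k; rewrite !inE.
- by move=> x; rewrite !inE.
- by move=> k _; rewrite -(card_slope F k); apply: eq_card => x; rewrite !inE.
- by move=> x y /[!inE] x0 y0; apply: TD_adj.
- by rewrite -cardE -card_perp_fixed; apply: eq_card => k; rewrite !inE.
- by rewrite cardsT card_option -cardF addn1.
Qed.

(** The number of fixed points is the same for UD as for TD, since the slopes 0
    and infinity left out in UD are exchanged by perp. *)
Lemma disjoint_union_UD (F : finFieldType) (a b : nat) :
    #|[set t : F | t ^+ 2 == -1]| = a -> (#|F| - 1 = a + 2 * b)%N ->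
  disjoint_union_of (UD F)
    (fun i : 'I_a + 'I_b =>
       if i is inl _ then complete_graph (#|F| - 1)
       else complete_bipartite (#|F| - 1) (#|F| - 1)).
Proof.
move=> cardE cardF.
have vUD x :
    (x \in vset (UD F)) = (x != 0) && (slope x \notin [set None; Some 0]).
  by rewrite !inE unit_pair_slope !inE andbA andbb.
have perpD (k : option F) :
    (perp k \in [set None; Some 0]) = (k \in [set None; Some 0]).
  by rewrite !inE !(can2_eq (@perpK F) (@perpK F)) /= eqxx orbC.
apply: (@disjoint_union_orbits (UD F) (option F) slope perp
  (~: [set None; Some 0])).
- exact: perpK.
- by move=> k; rewrite !in_setC perpD.
- by move=> x; rewrite vUD in_setC => /andP[].
- move=> k; rewrite in_setC => kD; rewrite -(card_slope F k); apply: eq_card => x.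
  rewrite [LHS]in_set [RHS]in_set vUD.
  have [->|_] := eqVneq (slope x) k; last by rewrite !andbF.
  by rewrite kD !andbT.
- move=> x y; rewrite !vUD => /andP[x0 xD] /andP[y0 yD].
  by rewrite induced_adj TD_adj // !inE !unit_pair_slope x0 y0 xD yD !andbT.
- rewrite -cardE -card_perp_fixed; apply: eq_card => k; rewrite !inE.
  by case: k => [t|] //=; rewrite (inj_eq Some_inj); case: (t == 0).
- by rewrite cardsCs setCK cards2 card_option -cardF subn2 subn1.
Qed.

Lemma ZD_zero_divisor_graph (F : finFieldType) :
  ZD F = zero_divisor_graph (F * F)%type.
Proof.
transitivity (rel_graph ([set~ 0] :&: (zero_divisors (F * F)%type :\ 0))
                        (fun x y : F * F => dot x y == 0)).
  exact: induced_rel_graph.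
apply: eq_rel_graph.
  by apply/setP=> x; rewrite !inE andbA andbb.
move=> x y; rewrite in_setI zero_divisors_coord => xZ _ _.
rewrite /dot -pair_eqE /pair_eq /=; move: xZ => /andP[_ /andP[_]].
by case/orP=> /eqP->; rewrite !mul0r ?add0r ?addr0 eqxx ?andbT.
Qed.

Lemma isomorphic_ZD (F : finFieldType) :
  isomorphic (ZD F) (complete_bipartite (#|F| - 1) (#|F| - 1)).
Proof.
have ZD_adj (x y : F * F) (k l : option F) :
    k \in [set None; Some 0] -> l \in [set None; Some 0] ->
    x \in [set x | (x != 0) && (slope x == k)] ->
    y \in [set x | (x != 0) && (slope x == l)] -> @adj (ZD F) x y = (l != k).
  move=> kD lD; rewrite !inE => /andP[x0 /eqP xk] /andP[y0 /eqP yl].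
  rewrite induced_adj TD_adj // !zero_divisors_slope x0 y0 xk yl kD lD !andbT.
  have [eq_xy|_] := eqVneq x y; first by rewrite -xk -yl eq_xy eqxx.
  by case/set2P: kD => ->; case/set2P: lD => ->; rewrite /= ?eqxx.
apply: (@isomorphic_complete_bipartite (ZD F)
  [set x | (x != 0) && (slope x == None)]
  [set x | (x != 0) && (slope x == Some 0)]).
- apply/setP=> x; rewrite in_setI zero_divisors_slope !inE.
  by case: (x != 0).
- apply/pred0P=> x /=; rewrite !inE; apply/negP=> /andP[/andP[_ /eqP->]].
  by rewrite andbF.
- exact: card_slope.
- exact: card_slope.
- by move=> x y xs ys; rewrite (ZD_adj x y None (Some 0)) // ?inE ?eqxx ?orbT.
- by move=> x y xs ys; rewrite (ZD_adj x y None None) // ?inE ?eqxx ?orbT.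
- by move=> x y xs ys; rewrite (ZD_adj x y (Some 0) (Some 0)) // ?inE ?eqxx ?orbT.
Qed.

Local Close Scope ring_scope.

Theorem theorem2p2 (p n : nat) (p_prime : prime p) (p_ge3 : (3 <= p)%N)
    (n_ge1 : (1 <= n)%N) (F : finFieldType) (cardF : #|F| = (p ^ n)%N) :
  let m := (p ^ n - 1)%N in
  [/\ ZD F = zero_divisor_graph (F * F)%type /\
        isomorphic (zero_divisor_graph (F * F)%type) (complete_bipartite m m),
      ~~ (4 %| m)%N ->
        disjoint_union_of (UD F)
          (fun _ : 'I_(m %/ 2) => complete_bipartite m m),
      (4 %| m)%N ->
        disjoint_union_of (UD F)
          (fun i : 'I_2 + 'I_((m - 2) %/ 2) =>
             if i is inl _ then complete_graph m else complete_bipartite m m),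
      ~~ (4 %| m)%N ->
        disjoint_union_of (TD F)
          (fun _ : 'I_((m + 2) %/ 2) => complete_bipartite m m) &
      (4 %| m)%N ->
        disjoint_union_of (TD F)
          (fun i : 'I_2 + 'I_(m %/ 2) =>
             if i is inl _ then complete_graph m else complete_bipartite m m)].
Proof.
move=> m.
have odd_q : odd (p ^ n).
  by rewrite oddX; case: (even_prime p_prime) p_ge3 => [->|->]; rewrite ?orbT.
have q_ge3 : 3 <= p ^ n.
  by rewrite (leq_trans p_ge3) // -{1}(expn1 p) leq_pexp2l // prime_gt0.
have cardE := card_sqrtN1 F; rewrite cardF -/m in cardE.
have unionTD := disjoint_union_TD F; rewrite cardF -/m in unionTD.
have unionUD := disjoint_union_UD F; rewrite cardF -/m in unionUD.
have isoZD := isomorphic_ZD F; rewrite cardF -/m in isoZD.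
split.
- by rewrite -ZD_zero_divisor_graph.
- move=> m4; apply/disjoint_union_inr/unionUD; last by lia.
  by rewrite cardE // (negbTE m4).
- by move=> m4; apply: unionUD; [rewrite cardE // m4 | lia].
- move=> m4; apply/disjoint_union_inr/unionTD; last by lia.
  by rewrite cardE // (negbTE m4).
- by move=> m4; apply: unionTD; [rewrite cardE // m4 | lia].
Qed.
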